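(* Let $A\in\mathbb{R}^{n\times n}$ be symmetric with eigenvalues $\lambda_1>\lambda_2\ge\cdots\ge\lambda_n$ and $\lambda_1>0$, let $v_1$ be a unit eigenvector of $A$ for $\lambda_1$, and let $f(x)=\|A-xx^\top\|_F^2$, with minimum value $f^*$ and set of minimizers $X^*=\{\pm\sqrt{\lambda_1}v_1\}$. Let the iteration follow GCD-LS-LS. Then for any $x^{(0)}\in D^+\cup D^-$ and every $\ell\ge0$, $$\mathbb{E}\left[f(x^{(\ell)})\mid x^{(0)}\right]-f^*\le\left(1-\frac{\mu_1}{L}\right)^{\ell}\left(f(x^{(0)})-f^*\right).$$ Moreover, $$\mathbb{E}\left[\operatorname{dist}(x^{(\ell)},X^* )^2\mid x^{(0)}\right]\le\frac{2}{\mu_2}\left(1-\frac{\mu_1}{L}\right)^{\ell}\left(f(x^{(0)})-f^*\right).$$ Here $L=12\lambda_1+2\min(2\lambda_1,\lambda_1-\lambda_2)+4\max_i|A_{i,i}|$, and $\mu_1>0$ and $\mu_2>0$ are constants such that $f$ is strongly $\|\cdot\|_1$-convex with constant $\mu_1$ and strongly $\|\cdot\|_2$-convex with constant $\mu_2$ on each of $B^+$ and $B^-$.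
   Context: $\|\cdot\|_F$ is the Frobenius norm, $\|\cdot\|$ the Euclidean norm, $\|\cdot\|_p$ the vector $p$-norm, $e_j$ the $j$-th standard basis vector, and $\operatorname{dist}(x,X^* )=\min_{y\in X^*}\|x-y\|$. Balls around the minimizers: $B^\pm=\left\{y:\|y\mp\sqrt{\lambda_1}v_1\|\le\frac{1}{30}\frac{\min(2\lambda_1,\lambda_1-\lambda_2)}{\sqrt{\lambda_1}}\right\}$. Sublevel sets: $D^\pm=\{x\in B^\pm: f(x)\le\min_{y\in\partial B^\pm}f(y)\}$, where $\partial B^\pm$ is the boundary of $B^\pm$. Strong $\|\cdot\|_p$-convexity ($p\ge1$): a continuously differentiable $g$ is strongly $\|\cdot\|_p$-convex on $S$ with constant $\mu_p>0$ if $g(y)\ge g(x)+\nabla g(x)^\top(y-x)+\frac{\mu_p}{2}\|y-x\|_p^2$ for all $x,y\in S$. For $f$ on $B^\pm$ one may take $\mu_2=3\min(2\lambda_1,\lambda_1-\lambda_2)$, and constants $\mu_p>0$ exist for all $p\ge1$. The GCD-LS-LS iteration (greedy coordinate descent with exact line search along all coordinates) is $$x^{(\ell+1)}=x^{(\ell)}+\alpha_\ell e_{j_\ell},\qquad (\alpha_\ell,j_\ell)\in\operatorname*{arg\,min}_{\alpha\in\mathbb{R},\,1\le j\le n}f\bigl(x^{(\ell)}+\alpha e_j\bigr).$$ The iteration is deterministic (up to how ties are broken), so the expectations are those of deterministic quantities once tie-breaking is fixed. *)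

(* Defs.v *)
From HB Require Import structures.
From mathcomp Require Import all_boot all_order all_algebra.
From mathcomp Require Import all_classical all_reals all_analysis.

Set Implicit Arguments.
Unset Strict Implicit.
Unset Printing Implicit Defensive.

Import Order.TTheory GRing.Theory Num.Theory.
Import numFieldNormedType.Exports.

Local Open Scope classical_set_scope.
Local Open Scope ring_scope.

Definition frobenius (R : realType) (m n : nat) (M : 'M[R]_(m, n)) : R :=
  Num.sqrt (\sum_i \sum_j M i j ^+ 2).

(* The norm `|x| that the library puts on 'cV[R]_n is the sup norm, so the
   Euclidean norm and the p-norms are defined here. They all induce the
   library's topology on 'cV[R]_n, which is the one used below for boundary,
   continuous and differentiable. *)
Definition enorm (R : realType) (n : nat) (x : 'cV[R]_n) : R :=
  Num.sqrt (\sum_i x i 0 ^+ 2).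

Definition pnorm (R : realType) (n : nat) (p : R) (x : 'cV[R]_n) : R :=
  (\sum_i `|x i 0| `^ p) `^ p^-1.

Definition basis_vec (R : realType) (n : nat) (j : 'I_n) : 'cV[R]_n :=
  delta_mx j 0.

Definition dist (R : realType) (n : nat) (x : 'cV[R]_n) (X : set 'cV[R]_n) : R :=
  inf [set enorm (x - y) | y in X].

Definition minimum (R : realType) (T : Type) (g : T -> R) : R := inf (range g).

Definition minimizers (R : realType) (T : Type) (g : T -> R) : set T :=
  [set x | forall y, g x <= g y].

Definition boundary (T : topologicalType) (S : set T) : set T :=
  closure S `\` interior S.

Definition gradient (R : realType) (n : nat) (g : 'cV[R]_n.+1 -> R)
    (x : 'cV[R]_n.+1) : 'cV[R]_n.+1 :=
  \col_i 'D_(basis_vec R i) g x.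

Definition C1 (R : realType) (n : nat) (g : 'cV[R]_n.+1 -> R) : Prop :=
  (forall x, differentiable g x) /\ continuous (gradient g).

Definition strongly_convex (R : realType) (n : nat) (p mu : R)
    (g : 'cV[R]_n.+1 -> R) (S : set 'cV[R]_n.+1) : Prop :=
  C1 g /\
  forall x y, S x -> S y ->
    g x + ((gradient g x)^T *m (y - x)) 0 0 + mu / 2 * pnorm p (y - x) ^+ 2
      <= g y.

Definition objective (R : realType) (n : nat) (A : 'M[R]_n) (x : 'cV[R]_n) : R :=
  frobenius (A - x *m x^T) ^+ 2.

(* lam lists the eigenvalues of A with multiplicity, in nonincreasing order. *)
Definition ordered_spectrum (R : realType) (n : nat) (A : 'M[R]_n)
    (lam : 'I_n -> R) : Prop :=
  char_poly A = \prod_i ('X - (lam i)%:P) /\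
  (forall i j : 'I_n, (i <= j)%N -> lam j <= lam i).

Definition gap (R : realType) (l1 l2 : R) : R := Num.min (2 * l1) (l1 - l2).

(* B^+ is minimizer_ball l1 l2 (sqrt l1 *: v1) and
   B^- is minimizer_ball l1 l2 (- (sqrt l1 *: v1)). *)
Definition minimizer_ball (R : realType) (n : nat) (l1 l2 : R) (c : 'cV[R]_n) :
    set 'cV[R]_n :=
  [set y | enorm (y - c) <= 30^-1 * (gap l1 l2 / Num.sqrt l1)].

(* D^+ and D^- are obtained for B = B^+ and B = B^-. *)
Definition sublevel (R : realType) (n : nat) (g : 'cV[R]_n -> R)
    (B : set 'cV[R]_n) : set 'cV[R]_n :=
  [set x | B x /\ g x <= inf [set g y | y in boundary B]].

(* Ties in the argmin may be broken arbitrarily, at every iteration. *)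
Definition GCD_LS_LS (R : realType) (n : nat) (g : 'cV[R]_n -> R)
    (x : nat -> 'cV[R]_n) (alpha : nat -> R) (j : nat -> 'I_n) : Prop :=
  forall l : nat,
    x l.+1 = x l + alpha l *: basis_vec R (j l) /\
    (forall (a : R) (k : 'I_n),
       g (x l + alpha l *: basis_vec R (j l)) <= g (x l + a *: basis_vec R k)).

Definition smoothness (R : realType) (n : nat) (A : 'M[R]_n) (l1 l2 : R) : R :=
  12 * l1 + 2 * gap l1 l2 + 4 * \big[Num.max/0]_i `|A i i|.

(* Main.v *)
Require Import Defs.
From HB Require Import structures.
From mathcomp Require Import all_boot all_order all_fingroup all_algebra.
From mathcomp Require Import all_classical all_reals all_analysis.
From mathcomp Require Import complex ring lra.

Set Implicit Arguments.
Unset Strict Implicit.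
Unset Printing Implicit Defensive.

Import Order.TTheory GRing.Theory Num.Theory.
Import numFieldNormedType.Exports.

Local Open Scope classical_set_scope.
Local Open Scope ring_scope.

(** Up to a constant the objective is [- 2 x^T A x + |x|^4], and the proof has a
    global half and a local half.

    Global half. Write [x = a v1 + w] with [w] orthogonal to [v1]. The spectral
    theorem gives [w^T A w <= l2 |w|^2] ([rayleigh_orthogonal]), so the excess
    over the value at the minimizers is bounded below by a sum of nonnegative
    terms that all vanish only at [+- sqrt l1 v1] ([objective_excess]). With the direction of [w]
    fixed, the objective is moreover a convex quadratic in [(a^2, |w|^2)];
    following the segment to the minimizer in these variables, every point
    outside a ball, on its side of the hyperplane orthogonal to [v1], lies
    strictly above some point of the sphere ([sphere_below]). Hence a point with
    value at most the minimum over the spheres lies in one of the two balls. An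
    exact line search may jump from one ball to the other, but it cannot leave
    their union.

    Local half. Along a coordinate the objective is a quartic whose second-order
    remainder is at most [L / 2 h^2] as long as both endpoints lie in the
    concentric ball of twice the radius ([coordinate_smooth]). The step
    [- G / L], with [G] the partial derivative, therefore decreases the value by
    at least [G^2 / (2 L)] ([coordinate_step]). Strong convexity for the 1-norm
    is a Polyak-Lojasiewicz inequality in the dual norm, the maximum norm: the
    largest squared partial derivative is at least [2 mu1] times the excess
    ([strongly_convex1_PL]). The greedy exact line search does at least as well
    as this step along the best coordinate, so each iteration contracts the
    excess by [1 - mu1 / L] ([greedy_contraction]). The bound on the distance is
    strong convexity for the 2-norm at the minimizer, where the gradient
    vanishes. The ball around [- sqrt l1 v1] needs no separate treatment: all
    lemmas apply to the eigenvector [- v1]. *)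

(** * The Euclidean inner product on column vectors *)

Section DotProduct.
Context {R : realType} {n : nat}.
Implicit Types (x y z : 'cV[R]_n) (a : R).

Definition dotp x y : R := \sum_i x i 0 * y i 0.

Lemma dotpE x y : dotp x y = (x^T *m y) 0 0.
Proof. by rewrite mxE; apply: eq_bigr => i _; rewrite mxE. Qed.

Lemma dotpC x y : dotp x y = dotp y x.
Proof. by apply: eq_bigr => i _; rewrite mulrC. Qed.

Lemma dotpDr x y z : dotp x (y + z) = dotp x y + dotp x z.
Proof. by rewrite -big_split; apply: eq_bigr => i _; rewrite mxE mulrDr. Qed.

Lemma dotpZr a x y : dotp x (a *: y) = a * dotp x y.
Proof. by rewrite mulr_sumr; apply: eq_bigr => i _; rewrite mxE mulrCA. Qed.

Lemma dotpNr x y : dotp x (- y) = - dotp x y.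
Proof. by rewrite -scaleN1r dotpZr mulN1r. Qed.

Lemma dotpDl x y z : dotp (x + y) z = dotp x z + dotp y z.
Proof. by rewrite !(dotpC _ z) dotpDr. Qed.

Lemma dotpZl a x y : dotp (a *: x) y = a * dotp x y.
Proof. by rewrite !(dotpC _ y) dotpZr. Qed.

Lemma dotpNl x y : dotp (- x) y = - dotp x y.
Proof. by rewrite !(dotpC _ y) dotpNr. Qed.

Definition dotp_linear := (dotpDr, dotpDl, dotpNr, dotpNl, dotpZr, dotpZl).

Lemma dotp_ge0 x : 0 <= dotp x x.
Proof. by apply: sumr_ge0 => i _; rewrite -expr2 sqr_ge0. Qed.

Lemma dotp_eq0 x : dotp x x = 0 -> x = 0.
Proof.
move=> /eqP; rewrite psumr_eq0 => [/allP h|i _]; last by rewrite -expr2 sqr_ge0.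
apply/colP => i; rewrite mxE; apply/eqP.
by have := h i (mem_index_enum i); rewrite -expr2 sqrf_eq0.
Qed.

Lemma dotp_basis_vec i x : dotp (basis_vec R i) x = x i 0.
Proof.
rewrite /dotp (bigD1 i) //= big1 => [|k /negPf ki].
  by rewrite !mxE !eqxx addr0 mul1r.
rewrite !mxE.
by rewrite ki mul0r.
Qed.

Lemma enormE x : enorm x = Num.sqrt (dotp x x).
Proof. by rewrite /enorm; congr Num.sqrt; apply: eq_bigr => i _; rewrite expr2. Qed.

Lemma enorm_sqr x : enorm x ^+ 2 = dotp x x.
Proof. by rewrite enormE sqr_sqrtr ?dotp_ge0. Qed.

Lemma enorm_le x a : 0 <= a -> (enorm x <= a) = (dotp x x <= a ^+ 2).
Proof.
move=> a0; rewrite -enorm_sqr ler_pXn2r // nnegrE //.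
exact: sqrtr_ge0.
Qed.

Lemma dotp_mulmx_sym (A : 'M[R]_n) x y :
  A^T = A -> dotp x (A *m y) = dotp y (A *m x).
Proof.
by move=> As; rewrite [RHS]dotpC !dotpE trmx_mul As mulmxA.
Qed.

End DotProduct.

(** * Rayleigh quotients orthogonal to the top eigenvector *)

Section Spectral.
Context {R : realType}.
Local Notation C := R[i].
Local Notation toC := (real_complex R).

Lemma char_poly_unitary_conj n (P : 'M[C]_n) (d : 'rV[C]_n) :
  P \in unitmx ->
  char_poly (invmx P *m diag_mx d *m P) = \prod_i ('X - (d 0 i)%:P).
Proof.
move=> Pu; rewrite -[RHS](_ : char_poly (diag_mx d) = _); last first.
  rewrite char_poly_trig ?diag_mx_is_trig //.
  by apply: eq_bigr => i _; rewrite mxE eqxx mulr1n.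
have PP : map_mx polyC (invmx P) *m map_mx polyC P = 1%:M.
  by rewrite -map_mxM mulVmx // map_mx1.
rewrite /char_poly; have -> : char_poly_mx (invmx P *m diag_mx d *m P) =
    map_mx polyC (invmx P) *m char_poly_mx (diag_mx d) *m map_mx polyC P.
  by rewrite /char_poly_mx mulmxBr mulmxBl !map_mxM mul_mx_scalar -scalemxAl PP scalemx1.
by rewrite !det_mulmx mulrAC -det_mulmx PP det1 mul1r.
Qed.

(** The unitary diagonalization over the complex numbers, read off in
    coordinates. The characteristic polynomial determines the diagonal up to a
    permutation, and the coordinates [c] are renumbered by that permutation so
    that [c i] belongs to [lam i]. *)
Lemma spectral_coordinates n (A : 'M[R]_n) (lam : 'I_n -> R) :
  A^T = A -> ordered_spectrum A lam ->
  exists c : 'I_n -> 'cV[R]_n -> C,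
    (forall u v, toC (dotp u v) = \sum_i (c i u)^* * c i v) /\
    (forall u v, toC (dotp u (A *m v)) =
       \sum_i toC (lam i) * ((c i u)^* * c i v)).
Proof.
move=> As [charA _].
pose AC := map_mx toC A.
have conjR (x : R) : (toC x)^* = toC x by exact: conjc_real.
have ctr m p (B : 'M[R]_(m, p)) : map_mx Num.conj (map_mx toC B)^T = map_mx toC B^T.
  by apply/matrixP => i k; rewrite !mxE conjR.
have ACn : AC \is normalmx by apply/normalmxP; rewrite ctr As.
have /orthomx_spectralP := ACn.
set P := spectralmx AC; set d := spectral_diag AC => ACE.
have Pu : P \is unitarymx by exact: spectral_unitarymx.
have [s ds] : exists s : {perm 'I_n}, forall i, d 0 i = toC (lam (s i)).
  have : \prod_(x <- [tuple d 0 i | i < n]) ('X - x%:P) =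
         \prod_(x <- [tuple toC (lam i) | i < n]) ('X - x%:P).
    rewrite !big_tuple; under eq_bigr do rewrite tnth_mktuple.
    rewrite -(char_poly_unitary_conj d (unitarymx_unit Pu)) -ACE -map_char_poly.
    rewrite charA rmorph_prod; apply: eq_bigr => i _.
    by rewrite tnth_mktuple rmorphB /= map_polyX map_polyC.
  move=> /prod_XsubC_eq /tuple_permP[s ds]; exists s => i.
  have := congr1 (fun t => tnth t i) (val_inj ds).
  by rewrite !tnth_mktuple.
pose y (u : 'cV[R]_n) := P *m map_mx toC u.
have yT u : map_mx Num.conj (y u)^T = (map_mx toC u)^T *m invmx P.
  by rewrite /y trmx_mul map_mxM ctr invmx_unitary ?map_trmx.
have dotE u v (M : 'M[R]_n) : toC (dotp u (M *m v)) =
    ((map_mx toC u)^T *m map_mx toC M *m map_mx toC v) 0 0.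
  by rewrite dotpE mulmxA map_trmx -!map_mxM [RHS]mxE.
exists (fun i u => y u (s^-1%g i) 0); split=> u v.
  rewrite -{1}(mul1mx v) dotE map_mx1 -(mulVmx (unitarymx_unit Pu)) mulmxA -yT -mulmxA.
  rewrite mxE (reindex_inj (@perm_inj _ s^-1%g)) /=.
  by apply: eq_bigr => i _; rewrite !mxE.
rewrite dotE -/AC ACE !mulmxA -yT -!mulmxA -/(y v).
rewrite mxE (reindex_inj (@perm_inj _ s^-1%g)) /=.
apply: eq_bigr => i _; rewrite mul_diag_mx !mxE ds permKV.
by rewrite mulrCA.
Qed.

(** Every coordinate of [v] for an eigenvalue other than [lam ord0] vanishes
    because [v] attains the largest Rayleigh quotient; so [w], being orthogonal
    to [v], has no component on the top eigenvalue. *)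
Lemma rayleigh_orthogonal n (A : 'M[R]_n.+2) (lam : 'I_n.+2 -> R) v w :
  let l1 := lam ord0 in
  let l2 := lam (lift ord0 ord0) in
  A^T = A -> ordered_spectrum A lam -> l2 < l1 ->
  A *m v = l1 *: v -> 0 < dotp v v -> dotp v w = 0 ->
  dotp w (A *m w) <= l2 * dotp w w.
Proof.
move=> l1 l2 As specA l21 Av v0 vw.
have [c [cdot cA]] := spectral_coordinates As specA.
have lam2 i : i != ord0 -> lam i <= l2.
  move=> i0; case: specA => _; apply => /=.
  by rewrite /bump leq0n add1n lt0n; apply: contraNN i0 => /eqP i0; apply/eqP/val_inj.
have cv i : i != ord0 -> c i v = 0.
  move=> i0.
  have := cA v v; rewrite Av dotpZr rmorphM /= cdot mulr_sumr.
  move=> /eqP; rewrite -subr_eq0 -sumrB psumr_eq0 => [/allP/(_ i (mem_index_enum i))|k _].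
    rewrite /= -mulrBl -rmorphB mulf_eq0 mulrC mul_conjC_eq0.
    case/orP => /eqP // /complexI /eqP; rewrite subr_eq0 => /eqP l1i.
    by have := lam2 _ i0; rewrite -l1i leNgt l21.
  rewrite -mulrBl -rmorphB mulr_ge0 //= ?ler0c; last by rewrite mulrC mul_conjC_ge0.
  have [->|k0] := eqVneq k ord0; first by rewrite subrr.
  by rewrite subr_ge0 (le_trans (lam2 _ k0)) // ltW.
have c0 : c ord0 w = 0.
  have := cdot v w; rewrite vw (bigD1 ord0) //= big1 ?addr0 => [/esym/eqP|k k0]; last first.
    by rewrite cv // conjC0 mul0r.
  rewrite mulf_eq0 conjC_eq0 => /orP[/eqP c0|/eqP//].
  have := cdot v v; rewrite big1 => [/complexI vv|k _]; first by rewrite vv ltxx in v0.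
  by have [->|k0] := eqVneq k ord0; rewrite ?c0 ?cv // mulr0.
rewrite -lecR cA rmorphM /= cdot mulr_sumr; apply: ler_sum => i _.
have [->|i0] := eqVneq i ord0; first by rewrite c0 !mulr0.
by rewrite ler_wpM2r ?lecR ?lam2 // mulrC mul_conjC_ge0.
Qed.

End Spectral.

(** * The objective as a quartic form *)

Section Objective.
Context {R : realType} {n : nat} (A : 'M[R]_n).
Context (As : A^T = A).
Implicit Types (x y z v w : 'cV[R]_n).

Lemma frobenius_sqr (M : 'M[R]_n) :
  frobenius M ^+ 2 = \sum_i \sum_j M i j ^+ 2.
Proof.
by rewrite sqr_sqrtr // sumr_ge0 // => i _; rewrite sumr_ge0 // => k _; rewrite sqr_ge0.
Qed.

Lemma objectiveE x :
  objective A x = frobenius A ^+ 2 - 2 * dotp x (A *m x) + dotp x x ^+ 2.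
Proof.
rewrite /objective !frobenius_sqr expr2 /dotp big_distrlr /= mulr_sumr.
rewrite -sumrB -big_split /=; apply: eq_bigr => i _.
rewrite mxE !mulr_sumr -sumrB -big_split /=; apply: eq_bigr => k _.
by rewrite !mxE big_ord1 !mxE; ring.
Qed.

Lemma objectiveN x : objective A (- x) = objective A x.
Proof. by rewrite !objectiveE mulmxN !dotp_linear !opprK. Qed.

Lemma objective_ge0 x : 0 <= objective A x.
Proof. exact: sqr_ge0. Qed.

Lemma objective_along x v h :
  objective A (x + h *: v) = objective A x
    + h * (4 * (dotp x x * dotp x v - dotp v (A *m x)))
    + h ^+ 2 * (2 * dotp x x * dotp v v + 4 * dotp x v ^+ 2 - 2 * dotp v (A *m v))
    + h ^+ 3 * (4 * dotp x v * dotp v v) + h ^+ 4 * dotp v v ^+ 2.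
Proof.
rewrite !objectiveE mulmxDr -scalemxAr !dotp_linear (dotp_mulmx_sym x v As) (dotpC v x).
ring.
Qed.

End Objective.

(** * Global landscape of the objective *)

Section Landscape.
Context {R : realType} {n : nat} (A : 'M[R]_n) (l1 l2 : R) (v : 'cV[R]_n).
Context (As : A^T = A).
Context (Av : A *m v = l1 *: v).
Context (v1 : dotp v v = 1).
Context (l1_gt0 : 0 < l1).
Context (l2_lt : l2 < l1).
Context (rayleigh : forall w, dotp v w = 0 -> dotp w (A *m w) <= l2 * dotp w w).
Local Notation f := (objective A).
Local Notation xstar := (Num.sqrt l1 *: v).
Implicit Types (x y z w : 'cV[R]_n).

(** The cross terms vanish because [w] is orthogonal to [v] and hence to
    [A *m v]. The right-hand side is the quadratic in [(a ^+ 2, dotp w w)] on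
    which the whole landscape analysis rests. *)
Lemma objective_split a w : dotp v w = 0 ->
  f (a *: v + w) - f xstar =
    (a ^+ 2 + dotp w w - l1) ^+ 2 + 2 * (l1 * dotp w w - dotp w (A *m w)).
Proof.
move=> vw; have := sqr_sqrtr (ltW l1_gt0); move: (Num.sqrt l1) => s sE.
have wAv : dotp w (A *m v) = 0 by rewrite Av dotpZr dotpC vw mulr0.
rewrite !objectiveE mulmxDr -!scalemxAr !dotp_linear.
rewrite (dotp_mulmx_sym v w As) (dotpC w v) wAv vw Av dotpZr v1.
by rewrite -sE; ring.
Qed.

Lemma orthogonal_split x : exists a w, x = a *: v + w /\ dotp v w = 0.
Proof.
exists (dotp v x), (x - dotp v x *: v); split; first by rewrite addrC subrK.
by rewrite !dotp_linear v1 mulr1 subrr.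
Qed.

Lemma objective_excess a w : dotp v w = 0 ->
  (a ^+ 2 + dotp w w - l1) ^+ 2 + 2 * (l1 - l2) * dotp w w <= f (a *: v + w) - f xstar.
Proof.
by move=> vw; rewrite objective_split //; have := rayleigh vw; nra.
Qed.

Lemma objective_min x : f xstar <= f x.
Proof.
have [a [w [-> vw]]] := orthogonal_split x.
rewrite -subr_ge0 (le_trans _ (objective_excess a vw)) //.
rewrite addr_ge0 ?sqr_ge0 // !mulr_ge0 ?dotp_ge0 //.
by rewrite subr_ge0 ltW.
Qed.

Lemma objective_min_eq x : f x = f xstar -> x = xstar \/ x = - xstar.
Proof.
have [a [w [-> vw]]] := orthogonal_split x => fx.
have := objective_excess a vw; rewrite fx subrr.
have := dotp_ge0 w; have := sqr_ge0 (a ^+ 2 + dotp w w - l1) => s0 w0 h.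
have w00 : dotp w w = 0.
  apply/eqP; rewrite eq_le w0 andbT -(pmulr_rle0 _ (_ : 0 < l1 - l2)) ?subr_gt0 //.
  lra.
move: h; rewrite w00 mulr0 !addr0 => h.
have /eqP : (a ^+ 2 - l1) ^+ 2 == 0 by rewrite eq_le h sqr_ge0.
move/eqP; rewrite sqrf_eq0 subr_eq0 -[l1 in _ == l1](sqr_sqrtr (ltW l1_gt0)) eqf_sqr.
rewrite (dotp_eq0 w00) addr0 -scaleNr => /orP[]/eqP ->; by [left|right].
Qed.

Lemma minimizers_objective : minimizers f = [set xstar; - xstar].
Proof.
apply/seteqP; split => [x xmin|x [] -> y].
- apply: objective_min_eq; apply/eqP; rewrite eq_le objective_min andbT.
  exact: xmin.
- exact: objective_min.
- by rewrite objectiveN; exact: objective_min.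
Qed.

Lemma minimum_objective : minimum f = f xstar.
Proof.
apply/eqP; rewrite eq_le; apply/andP; split.
  apply: ge_inf; last by exists xstar.
  by exists 0 => _ [x _ <-]; exact: objective_ge0.
by apply: lb_le_inf => [|_ [x _ <-]]; [exists (f xstar), xstar|exact: objective_min].
Qed.

(** In the variables [a ^+ 2] and [dotp w w], with the direction of [w] fixed,
    the objective is a convex quadratic, so it decreases strictly along the
    segment to its minimizer. Lifted back to vectors, this segment is a curve
    from [x] to [xstar], which must cross the sphere. *)
Lemma sphere_below x r : 0 <= dotp v x -> r < dotp (x - xstar) (x - xstar) -> 0 <= r ->
  exists2 z, dotp (z - xstar) (z - xstar) = r & f z < f x.
Proof.
move=> vx xr r0.
have fx : f x <> f xstar.
  move=> /objective_min_eq[] xE; move: vx xr; rewrite xE.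
    by rewrite subrr => _; rewrite -(scale0r v) dotpZl mul0r ltNge r0.
  by rewrite !dotp_linear v1 mulr1 oppr_ge0 leNgt sqrtr_gt0 l1_gt0.
move: vx xr fx; have [a [w [-> vw]]] := orthogonal_split x.
rewrite [dotp v _]dotpDr dotpZr v1 vw mulr1 addr0 => a0 xr fx.
pose s := Num.sqrt l1.
have sE : s ^+ 2 = l1 by rewrite sqr_sqrtr // ltW.
have distE b (u : 'cV[R]_n) : dotp v u = 0 ->
    dotp (b *: v + u - xstar) (b *: v + u - xstar) = (b - s) ^+ 2 + dotp u u.
  by move=> vu; rewrite !dotp_linear (dotpC u v) vu v1 -/s; ring.
(* The curve is [p t *: v + Num.sqrt (1 - t) *: w]: its squared coordinates are
   affine in [t]; [g t] is its squared distance to [xstar]. *)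
pose p t := Num.sqrt ((1 - t) * a ^+ 2 + t * l1).
pose g t := (p t - s) ^+ 2 + (1 - t) * dotp w w.
have g0 : r < g 0.
  rewrite /g /p subr0 !mul1r mul0r addr0 sqrtr_sqr ger0_norm //.
  by rewrite -distE.
have g1 : g 1 = 0 by rewrite /g /p subrr !mul0r mul1r add0r subrr expr0n addr0.
have gcont : continuous g.
  have lin : continuous (fun t : R => 1 - t).
    by move=> t; apply: cvgB; [exact: cvg_cst|exact: cvg_id].
  have pcont : continuous p.
    move=> t; apply: continuous_comp; last exact: sqrt_continuous.
    by apply: cvgD; apply: cvgM; [exact: lin|exact: cvg_cst|exact: cvg_id|exact: cvg_cst].
  move=> t; apply: cvgD; last by apply: cvgM; [exact: lin|exact: cvg_cst].
  apply: (@continuous_comp _ _ _ (fun t => p t - s) (fun u => u ^+ 2)).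
    by apply: cvgB; [exact: pcont|exact: cvg_cst].
  exact: exprn_continuous.
have [t t01 gt] : exists2 t, t \in `[0, 1] & g t = r.
  apply: IVT => //; first exact: continuous_subspaceT.
  by rewrite g1 ge_min r0 orbT le_max ltW.
have /andP[t0 t1] : 0 < t <= 1.
  move: t01; rewrite in_itv /= => /andP[t0 ->]; rewrite andbT lt0r t0 andbT.
  by apply: contraTneq g0 => t00; rewrite -t00 gt ltxx.
have vw' : dotp v (Num.sqrt (1 - t) *: w) = 0 by rewrite dotpZr vw mulr0.
have s1t : Num.sqrt (1 - t) ^+ 2 = 1 - t by rewrite sqr_sqrtr // subr_ge0.
exists (p t *: v + Num.sqrt (1 - t) *: w).
  by rewrite distE // -gt /g !dotp_linear mulrA -expr2 s1t.
have fx0 : 0 < f (a *: v + w) - f xstar.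
  rewrite subr_gt0 lt_neqAle objective_min andbT.
  by apply/eqP => fE; apply: fx; rewrite fE.
suff : f (p t *: v + Num.sqrt (1 - t) *: w) - f xstar <=
    (1 - t) * (f (a *: v + w) - f xstar).
  by nra.
have pt : p t ^+ 2 = (1 - t) * a ^+ 2 + t * l1.
  by rewrite sqr_sqrtr // addr_ge0 // mulr_ge0 ?sqr_ge0 ?subr_ge0 // ltW.
rewrite !objective_split // pt -scalemxAr !dotp_linear !(mulrA (Num.sqrt _)) -expr2 s1t.
rewrite -subr_ge0 (_ : _ - _ = t * (1 - t) * (a ^+ 2 + dotp w w - l1) ^+ 2); last by ring.
by apply: mulr_ge0; [apply: mulr_ge0; rewrite ?subr_ge0 // ltW|exact: sqr_ge0].
Qed.

End Landscape.

(** * Partial derivatives and second-order bounds along a coordinate *)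

Section Gradient.
Context {R : realType} {n : nat} (A : 'M[R]_n.+1) (As : A^T = A).
Local Notation f := (objective A).
Implicit Types (x y z v : 'cV[R]_n.+1).

Lemma derive_objective x v :
  'D_v f x = 4 * (dotp x x * dotp x v - dotp v (A *m x)).
Proof.
rewrite /derive; apply: cvg_lim => //.
set d := 4 * _.
pose c2 := 2 * dotp x x * dotp v v + 4 * dotp x v ^+ 2 - 2 * dotp v (A *m v).
pose c3 := 4 * dotp x v * dotp v v.
pose q h := d + h * (c2 + h * (c3 + h * dotp v v ^+ 2)).
have qcont : q @ (0 : R) --> q 0.
  do 3 (apply: cvgD; first exact: cvg_cst; apply: cvgM; first exact: cvg_id).
  exact: cvg_cst.
have -> : d = q 0 by rewrite /q mul0r addr0.
have {}qcont : q @ (0 : R)^' --> q 0.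
  by apply: cvg_trans qcont; apply: cvg_app; exact: cvg_within.
apply: cvg_trans qcont.
apply: near_eq_cvg; near=> h.
have h0 : h != 0 by near: h; exact: nbhs_dnbhs_neq.
rewrite /= (addrC (h *: v)) objective_along // /q /d /c2 /c3 /GRing.scale /=.
by field.
Unshelve. all: by end_near. Qed.

Lemma gradient_objective x i :
  gradient f x i 0 = 4 * (dotp x x * x i 0 - (A *m x) i 0).
Proof. by rewrite mxE derive_objective (dotpC x (basis_vec R i)) !dotp_basis_vec. Qed.

(** The cubic and quartic terms in [h] are absorbed by the square of the sum of
    the old and the new coordinate, which makes the remainder easy to bound by
    the norms of the two endpoints alone. *)
Lemma objective_coordinate x i h : let y := x + h *: basis_vec R i in
  f y = f x + h * gradient f x i 0
    + h ^+ 2 * (2 * dotp x x + (x i 0 + y i 0) ^+ 2 - 2 * A i i).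
Proof.
have Aii : dotp (basis_vec R i) (A *m basis_vec R i) = A i i.
  by rewrite dotp_basis_vec -colE mxE.
have ee : dotp (basis_vec R i) (basis_vec R i) = 1.
  by rewrite dotp_basis_vec mxE !eqxx.
rewrite /= objective_along // gradient_objective Aii ee.
rewrite (dotpC x (basis_vec R i)) !dotp_basis_vec.
by rewrite !mxE !eqxx /= mulr1n; ring.
Qed.

Lemma sqr_coord_le_dotp x i : x i 0 ^+ 2 <= dotp x x.
Proof.
rewrite /dotp (bigD1 i) //= expr2 lerDl.
by apply: sumr_ge0 => k _; rewrite -expr2 sqr_ge0.
Qed.

Lemma objective_coordinate_le x i h (M K : R) : let y := x + h *: basis_vec R i in
  dotp x x <= M -> dotp y y <= M -> - A i i <= K ->
  f y <= f x + h * gradient f x i 0 + h ^+ 2 * (6 * M + 2 * K).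
Proof.
move=> y xM yM AK; rewrite objective_coordinate lerD2l ler_wpM2l ?sqr_ge0 //.
have := sqr_coord_le_dotp x i; have := sqr_coord_le_dotp y i; rewrite -/y.
by have := sqr_ge0 (x i 0 - y i 0); nra.
Qed.

End Gradient.

(** * Spheres are boundaries of Euclidean balls *)

Section Balls.
Context {R : realType} {n : nat}.
Implicit Types (x y z c : 'cV[R]_n.+1).

(** A sup-norm neighbourhood of [z] contains a point slightly further out on the
    ray from [c] through [z], so [z] is not interior. *)
Lemma boundary_ball c z (r : R) : 0 < r -> enorm (z - c) = r ->
  boundary [set y | enorm (y - c) <= r] z.
Proof.
move=> r0 zr; split; first by apply: subset_closure; rewrite /= zr.
rewrite /interior /= => /nbhs_ballP[e /= e0 ze].
pose t := e / 2 / (1 + `|z - c|).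
have t0 : 0 < t by rewrite !divr_gt0 // ltr_pwDl.
have /ze /= : ball z e (z + t *: (z - c)).
  rewrite -ball_normE /ball_ /= opprD addNKr normrN normrZ gtr0_norm //.
  have N0 : 1 + `|z - c| != 0 by rewrite lt0r_neq0 // ltr_pwDl.
  have : t * (1 + `|z - c|) = e / 2 by rewrite /t divfK.
  by rewrite mulrDr mulr1; lra.
rewrite addrAC -{1}(scale1r (z - c)) -scalerDl enorm_le ?(ltW r0) //.
rewrite dotpZl dotpZr -enorm_sqr zr mulrA ger_pMl ?exprn_gt0 //.
by nra.
Qed.

End Balls.
(** * Strong convexity for the 1-norm *)

Section Convex.
Context {R : realType} {n : nat}.
Implicit Types (x y z c : 'cV[R]_n.+1).

Lemma pnorm1E x : pnorm 1 x = \sum_i `|x i 0|.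
Proof.
rewrite /pnorm invr1 powRr1; last by apply: sumr_ge0 => i _; exact: powR_ge0.
by apply: eq_bigr => i _; rewrite powRr1.
Qed.

Lemma pnorm2E x : pnorm 2 x = enorm x.
Proof.
rewrite /pnorm /enorm -powR12_sqrt; last by rewrite sumr_ge0 // => i _; rewrite sqr_ge0.
congr (_ `^ _); apply: eq_bigr => i _.
by rewrite (powR_mulrn 2) // real_normK // num_real.
Qed.

(** Hoelder pairs the 1-norm of [c - x] with the largest partial derivative [G];
    the quadratic [G * D - mu / 2 * D ^+ 2] in the 1-norm [D] is at most
    [G ^+ 2 / (2 * mu)]. *)
Lemma strongly_convex1_PL (f : 'cV[R]_n.+1 -> R) (S : set 'cV[R]_n.+1) mu x c :
  0 < mu -> strongly_convex 1 mu f S -> S x -> S c ->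
  exists i, f x - f c <= gradient f x i 0 ^+ 2 / (2 * mu).
Proof.
move=> mu0 [_ sc] Sx Sc; have := sc _ _ Sx Sc; rewrite pnorm1E.
set g := gradient f x; set d := c - x => scx.
have [i _ gi] := @arg_maxP _ _ _ ord0 predT (fun i => `|g i 0|) isT.
have gd : - (`|g i 0| * \sum_k `|d k 0|) <= (g^T *m d) 0 0.
  rewrite -dotpE mulr_sumr -sumrN ler_sum // => k _.
  by apply: lerNnormlW; rewrite normrM ler_wpM2r //; exact: gi.
exists i; rewrite -(real_normK (num_real (g i 0))) ler_pdivlMr ?mulr_gt0 //.
move: gd scx; set G := `|g i 0|; set D := \sum_k `|d k 0| => gd scx.
have fxc : f x - f c <= G * D - mu / 2 * D ^+ 2 by lra.
have mu2 : 0 <= 2 * mu by lra.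
rewrite (le_trans (ler_wpM2r mu2 fxc)) //.
by have := sqr_ge0 (G - mu * D); lra.
Qed.

End Convex.

(** * One greedy step from a ball *)

Section CoordinateStep.
Context {R : realType} {n : nat} (A : 'M[R]_n.+1) (l1 l2 : R) (v : 'cV[R]_n.+1).
Context (As : A^T = A) (Av : A *m v = l1 *: v) (v1 : dotp v v = 1).
Context (l1_gt0 : 0 < l1) (l2_lt : l2 < l1).
Context (rayleigh : forall w, dotp v w = 0 -> dotp w (A *m w) <= l2 * dotp w w).
Local Notation f := (objective A).
Local Notation s := (Num.sqrt l1).
Local Notation xstar := (s *: v).
Local Notation L := (smoothness A l1 l2).
Local Notation r := (30^-1 * (gap l1 l2 / Num.sqrt l1)).
Implicit Types (c x y z w : 'cV[R]_n.+1).

Lemma gap_gt0 : 0 < gap l1 l2.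
Proof. by rewrite lt_min subr_gt0 l2_lt mulr_gt0. Qed.

Lemma radius_gt0 : 0 < r.
Proof. by rewrite mulr_gt0 ?invr_gt0 ?divr_gt0 ?gap_gt0 ?sqrtr_gt0. Qed.

(** The two quantities that occur in [(s + 2 * r) ^+ 2]; the second bound uses
    [gap l1 l2 <= 2 * l1]. *)
Lemma radius_bounds : 30 * (s * r) = gap l1 l2 /\ 450 * r ^+ 2 <= gap l1 l2.
Proof.
have s0 : 0 < s by rewrite sqrtr_gt0.
have sr : 30 * (s * r) = gap l1 l2.
  by rewrite mulrCA mulVKf ?pnatr_eq0 // mulrC divfK ?lt0r_neq0.
split=> //; have rle : 15 * r <= s.
  rewrite -(ler_pM2l s0) -expr2 (sqr_sqrtr (ltW l1_gt0)).
  have : gap l1 l2 <= 2 * l1 by rewrite ge_min lexx.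
  by lra.
by move: radius_gt0 sr rle; move: (30^-1 * _) => q q0 <- rle; nra.
Qed.

(** The triangle inequality in squared form; Cauchy-Schwarz is obtained from the
    nonnegativity of the squared norm of [rho *: x - a *: (y - x)]. *)
Lemma dotp_ball_le x y (a rho : R) : 0 < a -> 0 < rho ->
  dotp x x = a ^+ 2 -> dotp (y - x) (y - x) <= rho ^+ 2 -> dotp y y <= (a + rho) ^+ 2.
Proof.
move=> a0 rho0 xa; have -> : dotp y y = dotp (y - x + x) (y - x + x) by rewrite subrK.
move: (y - x) => d drho.
have : 0 <= dotp (rho *: x - a *: d) (rho *: x - a *: d) by exact: dotp_ge0.
rewrite !dotp_linear xa (dotpC d x) => h.
have xd : dotp x d <= a * rho.
  rewrite -(ler_pM2l (mulr_gt0 a0 rho0)).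
  have : a ^+ 2 * dotp d d <= a ^+ 2 * rho ^+ 2 by rewrite ler_wpM2l ?sqr_ge0 ?drho.
  by lra.
lra.
Qed.

Lemma smoothness_gt0 : 0 < L.
Proof.
have M0 : 0 <= \big[Num.max/0]_i `|A i i| by exact: bigmax_ge_id.
rewrite /smoothness ltr_wpDr ?mulr_ge0 // addr_gt0 ?mulr_gt0 //.
exact: gap_gt0.
Qed.

(** Squared norms in the doubled ball are at most [(s + 2 * r) ^+ 2], which is at
    most [l1 + gap l1 l2 / 6]; six times this bound plus twice the largest
    absolute diagonal entry is exactly [L / 2]. *)
Lemma coordinate_smooth x i h : let y := x + h *: basis_vec R i in
  dotp (x - xstar) (x - xstar) <= (2 * r) ^+ 2 ->
  dotp (y - xstar) (y - xstar) <= (2 * r) ^+ 2 ->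
  f y <= f x + h * gradient f x i 0 + L / 2 * h ^+ 2.
Proof.
move=> y xB yB.
have s0 : 0 < s by rewrite sqrtr_gt0.
have ss : s ^+ 2 = l1 by rewrite sqr_sqrtr // ltW.
have vv : dotp xstar xstar = s ^+ 2 by rewrite dotpZl dotpZr v1 mulr1.
have [sr rr] := radius_bounds; have r0 := radius_gt0.
have nb z : dotp (z - xstar) (z - xstar) <= (2 * r) ^+ 2 -> dotp z z <= l1 + gap l1 l2 / 6.
  have r20 : 0 < 2 * r by rewrite mulr_gt0.
  move=> /(dotp_ball_le s0 r20 vv) /le_trans; apply.
  move: ss sr rr; move: (30^-1 * _) => q.
  by move: (Num.sqrt l1) (gap l1 l2) => a g ss sr rr; nra.
have Ai : - A i i <= \big[Num.max/0]_k `|A k k|.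
  by apply: le_trans (le_bigmax _ _ i); rewrite lerNl lerNnormlW.
have := objective_coordinate_le As (nb _ xB) (nb _ yB) Ai.
by rewrite /smoothness; move: (\big[_/_]_k _) => M; lra.
Qed.

(** If the full step left the doubled ball, some shorter step would end exactly
    on the doubled sphere with a value below [kappa], against [sphere_below].
    Working in the doubled ball matters when [x] is on the original sphere: the
    crossing of the doubled sphere happens after a positive step, so the
    decrease there is strict. *)
Lemma coordinate_step x i kappa :
  (forall z, dotp (z - xstar) (z - xstar) = r ^+ 2 -> kappa <= f z) ->
  dotp (x - xstar) (x - xstar) <= r ^+ 2 -> f x <= kappa ->
  f (x + (- (gradient f x i 0 / L)) *: basis_vec R i)
    <= f x - gradient f x i 0 ^+ 2 / (2 * L).
Proof.
move=> sphere xB fx; set G := gradient f x i 0.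
have L0 := smoothness_gt0; have r0 := radius_gt0.
have [sr rr] := radius_bounds.
pose p t := x + (t * - (G / L)) *: basis_vec R i.
have B2 : r ^+ 2 < (2 * r) ^+ 2 by move: r0; move: (30^-1 * _) => q q0; nra.
have xB2 := le_trans xB (ltW B2).
have descent t : dotp (p t - xstar) (p t - xstar) <= (2 * r) ^+ 2 ->
    f (p t) <= f x - t * (2 - t) * (G ^+ 2 / (2 * L)).
  move=> /(coordinate_smooth xB2) /le_trans; apply; rewrite -/G.
  by rewrite le_eqVlt; apply/orP; left; apply/eqP; field; rewrite lt0r_neq0.
have p1 : p 1 = x + (- (G / L)) *: basis_vec R i by rewrite /p mul1r.
rewrite -p1; case: (leP (dotp (p 1 - xstar) (p 1 - xstar)) ((2 * r) ^+ 2)) => [/descent|far].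
  by lra.
exfalso.
have [t t01 tB] : exists2 t, t \in `[0, 1] & dotp (p t - xstar) (p t - xstar) = (2 * r) ^+ 2.
  apply: IVT => //.
    apply: continuous_subspaceT => t.
    pose e := - (G / L) *: basis_vec R i.
    have -> : (fun t => dotp (p t - xstar) (p t - xstar)) =
        (fun t => dotp (x - xstar) (x - xstar) + t * (2 * dotp e (x - xstar) + t * dotp e e)).
      apply/funext => u; rewrite /p -scalerA -/e addrAC; move: (x - xstar) e => d e.
      by rewrite dotpDr !dotpDl !dotpZl !dotpZr (dotpC d e); ring.
    do 2 (apply: cvgD; first exact: cvg_cst; apply: cvgM; first exact: cvg_id).
    exact: cvg_cst.
  have p0 : p 0 = x by rewrite /p mul0r scale0r addr0.
  by rewrite p0 ge_min xB2 le_max (ltW far) orbT.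
have /andP[t0 t1] : 0 < t <= 1.
  move: t01; rewrite in_itv /= => /andP[t0 ->]; rewrite andbT lt0r t0 andbT.
  apply: contraTneq xB => t00; move: tB.
  by rewrite t00 /p mul0r scale0r addr0 => ->; rewrite -ltNge.
have G0 : 0 < G ^+ 2 / (2 * L).
  apply: divr_gt0; last by rewrite mulr_gt0.
  rewrite exprn_even_gt0 //=.
  apply: contraTneq xB => G0; move: tB.
  by rewrite /p G0 mul0r oppr0 mulr0 scale0r addr0 => ->; rewrite -ltNge.
have fp : f (p t) < f x.
  rewrite (le_lt_trans (descent t _)) ?tB // ltrBlDr ltrDl pmulr_lgt0 // mulr_gt0 //.
  by rewrite subr_gt0 (le_lt_trans t1) // ltr1n.
(* The doubled ball does not reach the origin, hence stays on the side of [v]. *)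
have vp : 0 <= dotp v (p t).
  move: tB; move: (p t) => z zB.
  have s0 : 0 < s by rewrite sqrtr_gt0.
  rewrite -(pmulr_rge0 _ s0); move: zB; rewrite !dotp_linear v1 (dotpC z v).
  by have := dotp_ge0 z; have := gap_gt0; nra.
have pB : r ^+ 2 < dotp (p t - xstar) (p t - xstar) by rewrite tB.
have [z zB fz] := sphere_below As Av v1 l1_gt0 l2_lt rayleigh vp pB (sqr_ge0 _).
by have := sphere z zB; rewrite leNgt (lt_trans fz (lt_le_trans fp fx)).
Qed.

Lemma minimizer_ballE c x :
  minimizer_ball l1 l2 c x <-> dotp (x - c) (x - c) <= r ^+ 2.
Proof. by rewrite -enorm_le // ltW // radius_gt0. Qed.

Lemma minimizer_ball_center c : minimizer_ball l1 l2 c c.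
Proof. by apply/minimizer_ballE; rewrite subrr -(scale0r c) dotpZl mul0r sqr_ge0. Qed.

Lemma sublevel_sphere c x z : sublevel f (minimizer_ball l1 l2 c) x ->
  dotp (z - c) (z - c) = r ^+ 2 -> f x <= f z.
Proof.
move=> [_ fx] zB; apply: le_trans fx _; apply: ge_inf.
  by exists 0 => _ [y _ <-]; exact: objective_ge0.
exists z => //; apply: boundary_ball; first exact: radius_gt0.
by rewrite enormE zB sqrtr_sqr gtr0_norm // radius_gt0.
Qed.

Lemma sublevel_ball x kappa :
  (forall z, dotp (z - xstar) (z - xstar) = r ^+ 2 -> kappa <= f z) ->
  f x <= kappa -> 0 <= dotp v x -> minimizer_ball l1 l2 xstar x.
Proof.
move=> sphere fx vx; apply/minimizer_ballE; rewrite leNgt; apply/negP => far.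
have [z zB fz] := sphere_below As Av v1 l1_gt0 l2_lt rayleigh vx far (sqr_ge0 _).
by have := sphere z zB; rewrite leNgt (lt_le_trans fz fx).
Qed.

Lemma greedy_contraction x y mu kappa : 0 < mu ->
  strongly_convex 1 mu f (minimizer_ball l1 l2 xstar) ->
  (forall z, dotp (z - xstar) (z - xstar) = r ^+ 2 -> kappa <= f z) ->
  minimizer_ball l1 l2 xstar x -> f x <= kappa ->
  (forall a k, f y <= f (x + a *: basis_vec R k)) ->
  f y - f xstar <= (1 - mu / L) * (f x - f xstar).
Proof.
move=> mu0 sc sphere xB fx greedy.
have [i PL] := strongly_convex1_PL mu0 sc xB (minimizer_ball_center _).
have /minimizer_ballE xB' := xB.
have := le_trans (greedy _ _) (coordinate_step i sphere xB' fx).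
have L0 := smoothness_gt0; move: PL.
set G := gradient f x i 0; set D := f x - f xstar => PL fy.
have muL : 0 <= mu / L by rewrite divr_ge0 // ltW.
have := ler_wpM2l muL PL.
have -> : mu / L * (G ^+ 2 / (2 * mu)) = G ^+ 2 / (2 * L).
  by field; rewrite !lt0r_neq0.
by rewrite mulrBl mul1r /D; lra.
Qed.

Lemma gradient_minimizer : gradient f xstar = 0.
Proof.
apply/colP => i; rewrite gradient_objective // -scalemxAr Av dotpZl dotpZr v1.
rewrite !mxE mulr1 -expr2 (sqr_sqrtr (ltW l1_gt0)) mulrCA subrr mulr0 //.
Qed.

Lemma strongly_convex2_dist (S : set 'cV[R]_n.+1) mu x :
  0 < mu -> strongly_convex 2 mu f S -> S x -> S xstar ->
  enorm (x - xstar) ^+ 2 <= 2 / mu * (f x - f xstar).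
Proof.
move=> mu0 [_ sc] Sx Sc; have := sc _ _ Sc Sx.
rewrite gradient_minimizer -dotpE -(scale0r v) dotpZl mul0r addr0 pnorm2E => h.
rewrite mulrAC ler_pdivlMr //; lra.
Qed.

End CoordinateStep.

(** * Geometric decay along the iteration *)

Section Iteration.
Context {R : realType}.

(** Powers of a negative factor are not monotone, hence the second case: a
    nonnegative sequence contracted by a negative factor is identically zero. *)
Lemma geometric_bound (u : nat -> R) q :
  (forall l, 0 <= u l) -> (forall l, u l.+1 <= q * u l) ->
  forall l, u l <= q ^+ l * u 0%N.
Proof.
move=> u0 uS; have [q0|q0] := leP 0 q.
  elim=> [|l IH]; first by rewrite expr0 mul1r.
  by rewrite (le_trans (uS l)) // exprS -mulrA ler_wpM2l.
have uz l : u l = 0.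
  apply/eqP; rewrite eq_le u0 andbT -(nmulr_rge0 _ q0).
  exact: le_trans (u0 l.+1) (uS l).
by move=> l; rewrite !uz mulr0.
Qed.

Lemma dist_le n (x c : 'cV[R]_n) X : X c -> 0 <= dist x X <= enorm (x - c).
Proof.
move=> Xc; apply/andP; split.
  by apply: lb_le_inf => [|_ [y _ <-]]; [exists (enorm (x - c)), c|exact: sqrtr_ge0].
apply: ge_inf; last by exists c.
by exists 0 => _ [y _ <-]; exact: sqrtr_ge0.
Qed.

End Iteration.

Theorem corollary5p12 (R : realType) (n : nat) (A : 'M[R]_n.+2)
    (lam : 'I_n.+2 -> R) (v1 : 'cV[R]_n.+2) :
  let l1 := lam ord0 in
  let l2 := lam (lift ord0 ord0) in
  let f := objective A in
  let fstar := minimum f in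
  let Xstar := minimizers f in
  let xstar := Num.sqrt l1 *: v1 in
  let Bp := minimizer_ball l1 l2 xstar in
  let Bm := minimizer_ball l1 l2 (- xstar) in
  let Dp := sublevel f Bp in
  let Dm := sublevel f Bm in
  let L := smoothness A l1 l2 in
  A^T = A ->
  ordered_spectrum A lam ->
  l2 < l1 ->
  0 < l1 ->
  A *m v1 = l1 *: v1 ->
  enorm v1 = 1 ->
  Xstar = [set xstar; - xstar] /\
  forall mu1 mu2 : R,
    0 < mu1 ->
    0 < mu2 ->
    strongly_convex 1 mu1 f Bp ->
    strongly_convex 1 mu1 f Bm ->
    strongly_convex 2 mu2 f Bp ->
    strongly_convex 2 mu2 f Bm ->
    forall (x : nat -> 'cV[R]_n.+2) (alpha : nat -> R) (j : nat -> 'I_n.+2),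
      GCD_LS_LS f x alpha j ->
      (Dp `|` Dm) (x 0%N) ->
      forall l : nat,
        f (x l) - fstar <= (1 - mu1 / L) ^+ l * (f (x 0%N) - fstar) /\
        dist (x l) Xstar ^+ 2
          <= 2 / mu2 * (1 - mu1 / L) ^+ l * (f (x 0%N) - fstar).
Proof.
move=> l1 l2 f fstar Xstar xstar Bp Bm Dp Dm L As specA l21 l10 Av nv.
have v1v1 : dotp v1 v1 = 1 by rewrite -enorm_sqr nv expr1n.
have ray w : dotp v1 w = 0 -> dotp w (A *m w) <= l2 * dotp w w.
  by apply: (rayleigh_orthogonal As specA) => //; rewrite v1v1.
have XE : Xstar = [set xstar; - xstar] by exact: (minimizers_objective As Av v1v1 l10 l21 ray).
split=> // mu1 mu2 mu10 mu20 sc1p sc1m sc2p sc2m x alpha j gcd Dx0 l.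
have fsE : fstar = f xstar by exact: (minimum_objective As Av v1v1 l10 l21 ray).
have NAv : A *m (- v1) = l1 *: (- v1) by rewrite mulmxN Av scalerN.
have Nv1 : dotp (- v1) (- v1) = 1 by rewrite !dotp_linear opprK.
have Nray w : dotp (- v1) w = 0 -> dotp w (A *m w) <= l2 * dotp w w.
  by move=> /eqP; rewrite dotpNl oppr_eq0 => /eqP /ray.
have NxE : Num.sqrt l1 *: (- v1) = - xstar by rewrite scalerN.
pose r := 30^-1 * (gap l1 l2 / Num.sqrt l1).
(* The two spheres are exchanged by x |-> - x, which preserves f, so the bound
   over one of them is also a bound over the other. *)
have sphN c z : dotp (z - - c) (z - - c) = dotp (- z - c) (- z - c).
  by rewrite -opprD opprK !dotp_linear; ring.
have [sphp sphm] : (forall z, dotp (z - xstar) (z - xstar) = r ^+ 2 -> f (x 0%N) <= f z) /\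
    (forall z, dotp (z - - xstar) (z - - xstar) = r ^+ 2 -> f (x 0%N) <= f z).
  case: Dx0 => Dx0; split=> z zr.
  - exact: sublevel_sphere Dx0 zr.
  - rewrite /f -(objectiveN A z); apply: (sublevel_sphere l10 l21 Dx0).
    by rewrite -sphN.
  - rewrite /f -(objectiveN A z); apply: (sublevel_sphere l10 l21 Dx0).
    by rewrite sphN opprK.
  - exact: sublevel_sphere Dx0 zr.
have inB y : f y <= f (x 0%N) -> Bp y \/ Bm y.
  move=> fy; have [vy|vy] := leP 0 (dotp v1 y); [left|right].
    exact: (sublevel_ball As Av v1v1 l10 l21 ray sphp fy vy).
  rewrite /Bm -NxE; apply: (sublevel_ball As NAv Nv1 l10 l21 Nray _ fy).
    by rewrite NxE.
  by rewrite dotpNl oppr_ge0 ltW.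
have greedy k a i : f (x k.+1) <= f (x k + a *: basis_vec R i).
  by have [-> h] := gcd k; exact: h.
have x0 k : f (x k) <= f (x 0%N).
  elim: k => // k /(le_trans _); apply.
  by have := greedy k 0 (j k); rewrite scale0r addr0.
have fN : f (- xstar) = f xstar by exact: objectiveN.
have step k : f (x k.+1) - fstar <= (1 - mu1 / L) * (f (x k) - fstar).
  rewrite fsE; case: (inB _ (x0 k)) => xB.
    exact: (greedy_contraction As Av v1v1 l10 l21 ray mu10 sc1p sphp xB (x0 k) (greedy k)).
  rewrite -fN -NxE.
  apply: (greedy_contraction As NAv Nv1 l10 l21 Nray mu10 _ _ _ (x0 k) (greedy k));
    by rewrite NxE.
have fl : f (x l) - fstar <= (1 - mu1 / L) ^+ l * (f (x 0%N) - fstar).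
  apply: (@geometric_bound _ (fun k => f (x k) - fstar)) => // k.
  by rewrite fsE subr_ge0; exact: (objective_min As Av v1v1 l10 l21 ray).
split=> //; rewrite -mulrA.
have mu2P : 0 <= 2 / mu2 by rewrite divr_ge0 // ltW.
apply: le_trans (ler_wpM2l mu2P fl); rewrite fsE.
have dc c : Xstar c -> enorm (x l - c) ^+ 2 <= 2 / mu2 * (f (x l) - f xstar) ->
    dist (x l) Xstar ^+ 2 <= 2 / mu2 * (f (x l) - f xstar).
  move=> /(dist_le (x l))/andP[d0 dle]; apply: le_trans.
  by rewrite ler_pXn2r // nnegrE (le_trans d0).
case: (inB _ (x0 l)) => xB.
  apply: (dc xstar); first by rewrite XE; left.
  apply: (strongly_convex2_dist As Av v1v1 l10 mu20 sc2p xB).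
  exact: (minimizer_ball_center l10 l21 xstar).
apply: (dc (- xstar)); first by rewrite XE; right.
rewrite -fN -NxE.
apply: (strongly_convex2_dist As NAv Nv1 l10 mu20 sc2m); rewrite ?NxE //.
exact: (minimizer_ball_center l10 l21 (- xstar)).
Qed.
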